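(* Let $G$ be the free product of the infinite cyclic groups $\langle a\rangle$ and $\langle b\rangle$ amalgamated over the cyclic subgroups $\langle a^k\rangle$ and $\langle b^l\rangle$ (that is, $G=\langle a,b\mid a^k=b^l\rangle$), where $k=p_1^{\kappa_1}\cdots p_s^{\kappa_s}q_{s+1}^{\kappa_{s+1}}\cdots q_n^{\kappa_n}$ and $l=p_1^{\lambda_1}\cdots p_s^{\lambda_s}r_{s+1}^{\lambda_{s+1}}\cdots r_m^{\lambda_m}$ are the respective prime factorizations of $k$ and $l$. Then $\gamma_\omega(G)$ is the normal closure in $G$ of the subset $$\{[a^{c_i},b^{d_i}],\ [b^{e_i},a^{f_i}] : i\in\{1,\dots,s\}\},$$ where $c_i=p_i^{\kappa_i}$, $d_i=p_1^{\lambda_1}\cdots p_{i-1}^{\lambda_{i-1}}p_{i+1}^{\lambda_{i+1}}\cdots p_s^{\lambda_s}$, $e_i=p_i^{\lambda_i}$ and $f_i=p_1^{\kappa_1}\cdots p_{i-1}^{\kappa_{i-1}}p_{i+1}^{\kappa_{i+1}}\cdots p_s^{\kappa_s}$ for all $i\in\{1,\dots,s\}$.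
   Context: Commutators are $[a,b]=a^{-1}b^{-1}ab$. $\gamma_i(G)$ is the $i$-th term of the lower central series ($\gamma_1(G)=G$, $\gamma_{i+1}(G)=[\gamma_i(G),G]$) and $\gamma_\omega(G)=\bigcap_{i\ge1}\gamma_i(G)$. In the factorizations, $p_1,\dots,p_s$ are the primes dividing both $k$ and $l$, the $q_i$ are the remaining primes dividing $k$, and the $r_i$ are the remaining primes dividing $l$.
   Formalization: The case where k and l have no common prime (s = 0) is allowed only if k = 1 or l = 1: for coprime k, l > 1 the set is empty while γ_ω(G) = γ_2(G) is nontrivial (e.g. k = 2, l = 3), so the claim fails there. *)

(* Defs.v *)
From HB Require Import structures.
From mathcomp Require Import all_boot.
From mathcomp Require Import boolp classical_sets.

Set Implicit Arguments.
Unset Strict Implicit.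
Unset Printing Implicit Defensive.

Local Open Scope classical_set_scope.
Local Open Scope group_scope.
Local Open Scope quotient_scope.

(* [group_closed] is stated for boolean predicates; these are the versions for
   classical sets, so that [smallest] applies. *)
Section Subgroups.
Variable G : groupType.
Implicit Types (A B H : set G).

Definition subgroup H : Prop :=
  [/\ H 1, (forall x y, H x -> H y -> H (x * y))
    & (forall x, H x -> H x^-1)].

Definition normal_subgroup H : Prop :=
  subgroup H /\ (forall x g, H x -> H (x ^ g)).

Definition generated A : set G := smallest subgroup A.

Definition normal_closure A : set G := smallest normal_subgroup A.

Definition commutator_subgroup A B : set G :=
  generated [set z | exists x y, [/\ A x, B y & z = [~ x, y]]].

(* The series starts at index 1; as for the finite groups of the library, the
   meaningless term of index 0 is set to G. *)
Fixpoint lower_central (i : nat) : set G :=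
  match i with
  | 0 | 1 => setT
  | j.+1 => commutator_subgroup (lower_central j) setT
  end.

Definition lower_central_omega : set G :=
  \bigcap_(i in [set i : nat | (1 <= i)%N]) lower_central i.

End Subgroups.

Arguments lower_central G i : clear implicits.
Arguments lower_central_omega G : clear implicits.

(* The letter (x, false) stands for the generator x, and (x, true) for its
   inverse; [R u v] reads "u = v is a defining relation". *)
Section PresentedGroup.
Variables (X : choiceType).

Definition word : Type := seq (X * bool).

HB.instance Definition _ := Choice.on word.

Variable R : word -> word -> Prop.

Inductive word_eq : word -> word -> Prop :=
| WordRefl u : word_eq u u
| WordSym u v : word_eq u v -> word_eq v u
| WordTrans u v w : word_eq u v -> word_eq v w -> word_eq u w
| WordCat u u' v v' :
    word_eq u u' -> word_eq v v' -> word_eq (u ++ v) (u' ++ v')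
| WordCancel x e : word_eq [:: (x, e); (x, ~~ e)] [::]
| WordRel u v : R u v -> word_eq u v.

Definition word_eqb : rel word := fun u v => `[< word_eq u v >].

Lemma word_eqb_refl : reflexive word_eqb.
Proof. by move=> u; apply/asboolP; apply: WordRefl. Qed.

Lemma word_eqb_sym : symmetric word_eqb.
Proof. by move=> u v; apply/asboolP/asboolP; apply: WordSym. Qed.

Lemma word_eqb_trans : transitive word_eqb.
Proof.
by move=> v u w /asboolP uv /asboolP vw; apply/asboolP; apply: WordTrans vw.
Qed.

Canonical word_equiv := EquivRel word_eqb word_eqb_refl word_eqb_sym word_eqb_trans.

Definition presented : Type := {eq_quot word_equiv}.

HB.instance Definition _ := Choice.on presented.
HB.instance Definition _ := EqQuotient.on presented.

Lemma presented_eqP (u v : word) :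
  \pi_presented u = \pi_presented v <-> word_eq u v.
Proof. by split=> [/eqmodP/asboolP|uv]; last apply/eqmodP/asboolP. Qed.

Definition word_inv (u : word) : word := rev [seq (l.1, ~~ l.2) | l <- u].

Definition presented_one : presented := \pi_presented [::].
Definition presented_mul (g h : presented) : presented :=
  \pi_presented (repr g ++ repr h).
Definition presented_inv (g : presented) : presented :=
  \pi_presented (word_inv (repr g)).

Lemma word_eq_inv u v : word_eq u v -> word_eq (word_inv u) (word_inv v).
Proof.
have invl (w : word) : word_eq (word_inv w ++ w) [::].
  elim: w => [|[x e] w IHw]; first exact: WordRefl.
  rewrite /word_inv map_cons rev_cons cat_rcons -[(x, e) :: w]cat1s.
  apply: WordTrans IHw; apply: WordCat; first exact: WordRefl.
  rewrite -[X in word_eq _ X]cat0s -cat1s catA.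
  apply: WordCat; last exact: WordRefl.
  by have := WordCancel x (~~ e); rewrite negbK.
have invr (w : word) : word_eq (w ++ word_inv w) [::].
  have := invl (word_inv w); congr (word_eq (_ ++ _) _).
  rewrite /word_inv map_rev revK -map_comp -[RHS]map_id.
  by apply: eq_map => -[x e] /=; rewrite negbK.
move=> uv; apply: (@WordTrans _ (word_inv u ++ v ++ word_inv v)).
  rewrite -[X in word_eq X _]cats0; apply: WordCat; first exact: WordRefl.
  exact/WordSym/invr.
rewrite catA -[X in word_eq _ X]cat0s.
apply: WordCat; last exact: WordRefl.
apply: WordTrans (invl u); apply: WordCat; first exact: WordRefl.
exact: WordSym.
Qed.

Lemma presented_mulE (u v : word) :
  presented_mul (\pi u) (\pi v) = \pi_presented (u ++ v).
Proof. by apply/presented_eqP/WordCat; apply/presented_eqP; rewrite reprK. Qed.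

Lemma presented_invE (u : word) :
  presented_inv (\pi u) = \pi_presented (word_inv u).
Proof. by apply/presented_eqP/word_eq_inv/presented_eqP; rewrite reprK. Qed.

Lemma presented_mulA : associative presented_mul.
Proof.
elim/quotW=> u; elim/quotW=> v; elim/quotW=> w.
by rewrite !presented_mulE catA.
Qed.

Lemma presented_mul1g : left_id presented_one presented_mul.
Proof. by elim/quotW=> u; rewrite presented_mulE. Qed.

Lemma presented_mulg1 : right_id presented_one presented_mul.
Proof. by elim/quotW=> u; rewrite presented_mulE cats0. Qed.

Lemma presented_mulVg : left_inverse presented_one presented_inv presented_mul.
Proof.
elim/quotW=> u; rewrite presented_invE presented_mulE; apply/presented_eqP.
elim: u => [|[x e] u IHu]; first exact: WordRefl.
rewrite /word_inv map_cons rev_cons cat_rcons -[(x, e) :: u]cat1s.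
apply: WordTrans IHu; apply: WordCat; first exact: WordRefl.
rewrite -[X in word_eq _ X]cat0s -cat1s catA.
apply: WordCat; last exact: WordRefl.
by have := WordCancel x (~~ e); rewrite negbK.
Qed.

Lemma presented_mulgV : right_inverse presented_one presented_inv presented_mul.
Proof.
move=> g; rewrite -[LHS]presented_mul1g -{1}(presented_mulVg (presented_inv g)).
rewrite -presented_mulA (presented_mulA (presented_inv g)) presented_mulVg.
by rewrite presented_mul1g presented_mulVg.
Qed.

HB.instance Definition _ := isGroup.Build presented
  presented_mulA presented_mul1g presented_mulg1 presented_mulVg presented_mulgV.

Definition presented_gen (x : X) : presented := \pi_presented [:: (x, false)].

End PresentedGroup.

(* <a, b | a^k = b^l>, on the generators a = true and b = false. *)
Section CyclicAmalgam.
Variables k l : nat.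

Inductive amalgam_rel : word bool -> word bool -> Prop :=
| AmalgamRel : amalgam_rel (nseq k (true, false)) (nseq l (false, false)).

Definition amalgam : groupType := presented amalgam_rel.

Definition amalgam_a : amalgam := presented_gen amalgam_rel true.
Definition amalgam_b : amalgam := presented_gen amalgam_rel false.

Let pi_nseq (c : bool) (n : nat) :
  \pi_(presented amalgam_rel) (nseq n (c, false))
    = presented_gen amalgam_rel c ^+ n.
Proof.
elim: n => [//|n IHn]; rewrite expgS -IHn /=.
by rewrite [RHS]presented_mulE.
Qed.

Lemma amalgam_relE : amalgam_a ^+ k = amalgam_b ^+ l.
Proof.
by rewrite /amalgam_a /amalgam_b -!pi_nseq; apply/presented_eqP/WordRel.
Qed.

Lemma amalgam_generated :
  generated [set amalgam_a; amalgam_b] = [set: amalgam].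
Proof.
apply/seteqP; split=> // + _; elim/quotW=> u H [[H1 HM HV] sH].
have Hgen c : H (presented_gen amalgam_rel c).
  by case: c; apply: sH; [left|right].
elim: u => [//|[c e] u IHu].
rewrite -cat1s -presented_mulE; apply: HM => //.
case: e; last exact: Hgen.
by have := HV _ (Hgen c); rewrite [_^-1]presented_invE.
Qed.

Lemma amalgam_universal (H : groupType) (x y : H) :
  x ^+ k = y ^+ l ->
  exists f : {multiplicative amalgam -> H}, f amalgam_a = x /\ f amalgam_b = y.
Proof.
move=> xy.
pose letter (z : bool * bool) : H :=
  let g := if z.1 then x else y in if z.2 then g^-1 else g.
pose ev (u : word bool) : H := foldr (fun z h => letter z * h) 1 u.
have evM u v : ev (u ++ v) = ev u * ev v.
  by elim: u => [|z u IHu] /=; rewrite ?mul1g // IHu mulgA.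
have ev_eq u v : word_eq amalgam_rel u v -> ev u = ev v.
  elim=> //= {u v}.
  - by move=> u v w _ -> _ ->.
  - by move=> u u' v v' _ eu _ ev'; rewrite !evM eu ev'.
  - by case=> -[]; rewrite /letter /= mulg1 ?mulgV ?mulVg.
  move=> _ _ []; have ev_nseq c n : ev (nseq n (c, false)) = letter (c, false) ^+ n.
    by elim: n => //= n ->; rewrite expgS.
  by rewrite !ev_nseq.
pose f (g : amalgam) : H := ev (repr (g : presented amalgam_rel)).
have fE u : f (\pi_(presented amalgam_rel) u) = ev u.
  by apply/ev_eq/presented_eqP; rewrite reprK.
have fM (g h : amalgam) : f (g * h) = f g * f h.
  by rewrite -evM -fE.
pose fm := isMultiplicative.Build amalgam H f fM.
exists (HB.pack_for {multiplicative amalgam -> H} f fm).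
by rewrite /= /amalgam_a /amalgam_b !fE /= !mulg1.
Qed.

End CyclicAmalgam.

(* Main.v *)
(* Write z = a^k = b^l and n = k l. If some powers of x and of y with coprime
   exponents are central, then [x, y] lies in every term of the lower central
   series, which puts the given commutators in gamma_omega.

   Conversely, for each prime p dividing n let w_p be 1 modulo the p-part of n
   and 0 modulo its p'-part, and let pi_p be the endomorphism a |-> a^(w_p),
   b |-> b^(w_p). Modulo z its image is a free product of two cyclic p-groups;
   it acts by unitriangular matrices over F_p that detect every nonempty reduced
   word, and z has infinite order modulo [G, G], so pi_p kills gamma_omega.
   Modulo the given commutators the images of the pi_p commute with each other,
   so g |-> prod_p pi_p(g) is a homomorphism; as sum_p w_p = 1 modulo n, it
   agrees with the quotient map up to central factors, hence exactly on [G, G].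
   So the quotient map kills gamma_omega too. *)
From HB Require Import structures.
From mathcomp Require Import all_boot all_algebra.
From mathcomp Require Import boolp classical_sets.
Require Import Defs.

Set Implicit Arguments.
Unset Strict Implicit.
Unset Printing Implicit Defensive.

Local Open Scope classical_set_scope.
Local Open Scope group_scope.
Local Open Scope quotient_scope.

(** * Subgroups and the lower central series *)

Section GeneratedSubgroups.
Variable G : groupType.
Implicit Types (A B H N : set G).

Lemma generated_subgroup A : subgroup (generated A).
Proof.
split=> [H [[]]//|x y Hx Hy H sH|x Hx H sH]; have [[_ HM HV] _] := sH.
  by apply: HM; [exact: Hx|exact: Hy].
by apply: HV; exact: Hx.
Qed.

Lemma sub_generated A : A `<=` generated A.
Proof. by move=> x Ax H [_]; apply. Qed.

Lemma normal_closure_normal A : normal_subgroup (normal_closure A).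
Proof.
split; first split=> [H [[[]]]//|x y Hx Hy H sH|x Hx H sH].
- have [[[_ HM HV] _] _] := sH.
  by apply: HM; [exact: Hx|exact: Hy].
- have [[[_ HM HV] _] _] := sH.
  by apply: HV; exact: Hx.
- by move=> x g Hx H sH; have [[_ HJ] _] := sH; apply: HJ; exact: Hx.
Qed.

Lemma sub_normal_closure A : A `<=` normal_closure A.
Proof. by move=> x Ax H [_]; apply. Qed.

Lemma centralizer_subgroup (x : G) : subgroup [set y | commute x y].
Proof.
split=> [|y z|y]; [exact: commute1|exact: commuteM|exact: commuteV].
Qed.

Lemma preimage_subgroup (K : groupType) (f : UMagmaMorphism.type G K)
    (H : set K) :
  subgroup H -> subgroup (f @^-1` H).
Proof.
case=> H1 HM HV; split=> [|x y|x] /=.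
- by rewrite gmulf1.
- by rewrite gmulfM; apply: HM.
- by rewrite gmulfV; apply: HV.
Qed.

Lemma commutator_subgroupS A B C D :
  A `<=` B -> C `<=` D -> commutator_subgroup A C `<=` commutator_subgroup B D.
Proof.
move=> sAB sCD; apply: smallest_sub; first exact: generated_subgroup.
move=> _ [x [y [Ax Cy ->]]]; apply: sub_generated.
by exists x, y; split; [exact: sAB|exact: sCD|].
Qed.

Lemma lower_central_subgroup n : subgroup (lower_central G n).
Proof. by case: n => [|[|n]] //; apply: generated_subgroup. Qed.

Lemma lower_centralR n x y :
  lower_central G n.+1 x -> lower_central G n.+2 [~ x, y].
Proof. by move=> Lx; apply: sub_generated; exists x, y. Qed.

Lemma lower_central_decr n : lower_central G n.+2 `<=` lower_central G n.+1.
Proof. by elim: n => // n IHn; apply: commutator_subgroupS. Qed.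

Lemma lower_central_normal n : normal_subgroup (lower_central G n.+1).
Proof.
split=> [|x g Lx]; first exact: lower_central_subgroup.
have [_ LM _] := lower_central_subgroup n.+1.
have -> : x ^ g = x * [~ x, g] by rewrite mulVKg.
by apply: LM => //; apply: lower_central_decr; apply: lower_centralR.
Qed.

Lemma lower_central_omega_normal : normal_subgroup (lower_central_omega G).
Proof.
split; last first.
  by move=> x g Lx [|i] // _; apply: (lower_central_normal i).2; apply: Lx.
split=> [i _|x y Lx Ly i i_gt0|x Lx i i_gt0];
  have [L1 LM LV] := lower_central_subgroup i.
- exact: L1.
- by apply: LM; [apply: Lx|apply: Ly].
- by apply: LV; apply: Lx.
Qed.

End GeneratedSubgroups.

Lemma lower_central_morph (G H : groupType) (f : UMagmaMorphism.type G H) n x :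
  lower_central G n x -> lower_central H n (f x).
Proof.
case: n => [|n] //; elim: n x => // n IHn x.
apply: (@smallest_sub _ _ _ (f @^-1` lower_central H n.+2)).
  exact/preimage_subgroup/lower_central_subgroup.
move=> _ [y [z [Ly _ ->]]]; rewrite /preimage/= /mkset gmulfR.
by apply: lower_centralR; apply: IHn.
Qed.

Lemma lower_central_omega_morph (G H : groupType)
    (f : UMagmaMorphism.type G H) x :
  lower_central_omega G x -> lower_central_omega H (f x).
Proof. by move=> Lx i i_gt0; apply: lower_central_morph; apply: Lx. Qed.

(** * Quotient groups, and commutators of elements with coprime central powers *)

Section QuotientGroup.
Variables (G : groupType) (N : set G) (nN : normal_subgroup N).

Definition coset_eqb : rel G := fun x y => `[< N (x^-1 * y) >].

Lemma coset_eqb_refl : reflexive coset_eqb.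
Proof. by case: nN => -[N1 _ _] _ x; apply/asboolP; rewrite mulVg. Qed.

Lemma coset_eqb_sym : symmetric coset_eqb.
Proof.
case: nN => -[_ _ NV] _ x y.
by apply/asboolP/asboolP => /NV; rewrite invgM invgK.
Qed.

Lemma coset_eqb_trans : transitive coset_eqb.
Proof.
case: nN => -[_ NM _] _ y x z /asboolP xy /asboolP yz; apply/asboolP.
by have := NM _ _ xy yz; rewrite -mulgA mulVKg.
Qed.

Canonical coset_equiv :=
  EquivRel coset_eqb coset_eqb_refl coset_eqb_sym coset_eqb_trans.

Definition quotient_group : Type := {eq_quot coset_equiv}.

HB.instance Definition _ := Choice.on quotient_group.
HB.instance Definition _ := EqQuotient.on quotient_group.

Lemma quotient_eqP (x y : G) :
  \pi_quotient_group x = \pi_quotient_group y <-> N (x^-1 * y).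
Proof. by split=> [/eqmodP/asboolP|xy]; last apply/eqmodP/asboolP. Qed.

Definition quotient_one : quotient_group := \pi_quotient_group 1.
Definition quotient_mul (g h : quotient_group) : quotient_group :=
  \pi_quotient_group (repr g * repr h).
Definition quotient_inv (g : quotient_group) : quotient_group :=
  \pi_quotient_group (repr g)^-1.

Lemma quotient_mulE (x y : G) :
  quotient_mul (\pi x) (\pi y) = \pi_quotient_group (x * y).
Proof.
case: nN => -[_ NM _] NJ; apply/quotient_eqP.
set x' := repr _; set y' := repr _.
have xx' : N (x'^-1 * x) by apply/quotient_eqP; rewrite reprK.
have yy' : N (y'^-1 * y) by apply/quotient_eqP; rewrite reprK.
have -> : (x' * y')^-1 * (x * y) = (x'^-1 * x) ^ y' * (y'^-1 * y).
  by rewrite conjgE invgM !mulgA mulgK.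
by apply: NM => //; apply: NJ.
Qed.

Lemma quotient_invE (x : G) : quotient_inv (\pi x) = \pi_quotient_group x^-1.
Proof.
case: nN => -[_ _ NV] NJ; apply/quotient_eqP; rewrite invgK.
set x' := repr _.
have /NV/(NJ _ x'^-1) : N (x'^-1 * x) by apply/quotient_eqP; rewrite reprK.
by rewrite conjgE invgM !invgK !mulgA mulgK.
Qed.

Lemma quotient_mulA : associative quotient_mul.
Proof.
by elim/quotW=> x; elim/quotW=> y; elim/quotW=> z; rewrite !quotient_mulE mulgA.
Qed.

Lemma quotient_mul1g : left_id quotient_one quotient_mul.
Proof. by elim/quotW=> x; rewrite quotient_mulE mul1g. Qed.

Lemma quotient_mulg1 : right_id quotient_one quotient_mul.
Proof. by elim/quotW=> x; rewrite quotient_mulE mulg1. Qed.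

Lemma quotient_mulVg : left_inverse quotient_one quotient_inv quotient_mul.
Proof. by elim/quotW=> x; rewrite quotient_invE quotient_mulE mulVg. Qed.

Lemma quotient_mulgV : right_inverse quotient_one quotient_inv quotient_mul.
Proof. by elim/quotW=> x; rewrite quotient_invE quotient_mulE mulgV. Qed.

HB.instance Definition _ := isGroup.Build quotient_group
  quotient_mulA quotient_mul1g quotient_mulg1 quotient_mulVg quotient_mulgV.

Definition quotient_proj (x : G) : quotient_group := \pi_quotient_group x.

Lemma quotient_proj_monoid_morphism : monoid_morphism quotient_proj.
Proof. by split=> // x y; rewrite /quotient_proj -quotient_mulE. Qed.

HB.instance Definition _ := isUMagmaMorphism.Build G quotient_group
  quotient_proj quotient_proj_monoid_morphism.

Lemma quotient_proj_eq1 x : quotient_proj x = 1 <-> N x.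
Proof.
have [[_ _ NV] _] := nN; split=> [/quotient_eqP/NV|Nx].
  by rewrite mulg1 invgK.
by apply/quotient_eqP; rewrite mulg1; apply: NV.
Qed.

Lemma quotient_proj_surj y : exists x, y = quotient_proj x.
Proof. by elim/quotW: y => x; exists x. Qed.

End QuotientGroup.

(** By Bezout, [u * m = v * n + 1] for some [u] and [v]. This takes a positive [m], while [m = 0]
    forces [n = 1]. *)
Lemma expg_coprime_eq1 (G : groupType) (x : G) m n :
  coprime m n -> x ^+ m = 1 -> x ^+ n = 1 -> x = 1.
Proof.
case: m => [|m] co_mn xm xn.
  by move: co_mn; rewrite /coprime gcd0n => /eqP n1; rewrite n1 in xn.
case: (egcdnP n (ltn0Sn m)) => u v; rewrite (eqP co_mn) => uv _.
have: x ^+ (u * m.+1) = x ^+ (v * n) * x by rewrite uv expgnDr.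
by rewrite mulnC expgnA xm mulnC expgnA xn !expg1n mul1g.
Qed.

(** Conjugation by [y] turns [x] into [x * [~ x, y]]; when these factors commute, the n-th power
    splits. *)
Lemma commXg_commute (G : groupType) (x y : G) n :
  commute x [~ x, y] -> [~ x ^+ n, y] = [~ x, y] ^+ n.
Proof.
by move=> cxw; rewrite {1}/commg conjXg -[x ^ y](mulVKg x) expgMn // mulKg.
Qed.

(* If [~ x, y] lies in a term of the series, then modulo the next term it is
   central, so its m-th and n-th powers are [~ x ^+ m, y] = 1 and
   [~ x, y ^+ n] = 1; hence it lies in the next term. *)
Lemma coprime_commg_omega (G : groupType) (x y : G) m n :
    coprime m n ->
    (forall g, commute (x ^+ m) g) -> (forall g, commute (y ^+ n) g) ->
  lower_central_omega G [~ x, y].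
Proof.
move=> co_mn cx cy [|i] // _; elim: i => // i IHi.
have nL := lower_central_normal G i.+1.
pose f : UMagmaMorphism.type G (quotient_group nL) := quotient_proj nL.
have cw h : commute (f [~ x, y]) h.
  have [g ->] := quotient_proj_surj h; apply/commgP/eqP.
  by rewrite -gmulfR; apply/quotient_proj_eq1; apply: lower_centralR.
have cR u v j : (forall g, commute (u ^+ j) g) ->
    commute (f u) (f [~ u, v]) -> f [~ u, v] ^+ j = 1.
  move=> cu; rewrite gmulfR => cuw; rewrite -commXg_commute // -gmulfXn -gmulfR.
  by have /commgP/eqP-> := cu v; rewrite gmulf1.
apply/(quotient_proj_eq1 nL)/(expg_coprime_eq1 co_mn).
  exact/(cR x y)/commute_sym/cw.
(* The power of [y] is handled by the same fact applied to [[~ y, x]], the inverse of [[~ x, y]]. *)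
apply: invg_inj; rewrite invg1 -expVgn -gmulfV invgR.
by apply: cR => //; rewrite -invgR gmulfV; apply/commuteV/commute_sym/cw.
Qed.

(** * Unitriangular matrices and words *)

Section UpperBand.
Local Open Scope ring_scope.
Import GRing.Theory.
Variables (R : nzRingType) (d : nat).
Implicit Types A B : 'M[R]_d.+1.

(** Modelled on the n-th power of the ideal of strictly upper triangular matrices: widths add under
    multiplication, and width [d.+1] leaves only 0. *)
Definition upper_band n A := forall i j : 'I_d.+1, (j < i + n)%N -> A i j = 0.

Lemma upper_bandD n A B :
  upper_band n A -> upper_band n B -> upper_band n (A + B).
Proof. by move=> bA bB i j lt_ji; rewrite mxE bA // bB // addr0. Qed.

Lemma upper_bandN n A : upper_band n A -> upper_band n (- A).
Proof. by move=> bA i j lt_ji; rewrite mxE bA // oppr0. Qed.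

Lemma upper_bandM m n A B :
  upper_band m A -> upper_band n B -> upper_band (m + n) (A * B).
Proof.
move=> bA bB i j lt_ji; rewrite mxE big1 // => x _.
have [lt_xi|le_ix] := ltnP x (i + m); first by rewrite bA // mul0r.
by rewrite bB ?mulr0 // (leq_trans lt_ji) // addnA leq_add2r.
Qed.

Lemma upper_band0M n A B :
  upper_band 0 A -> upper_band n B -> upper_band n (A * B).
Proof. exact: upper_bandM. Qed.

Lemma upper_bandM0 n A B :
  upper_band n A -> upper_band 0 B -> upper_band n (A * B).
Proof. by rewrite -{2}[n]addn0; apply: upper_bandM. Qed.

Lemma upper_band_le m n A : (m <= n)%N -> upper_band n A -> upper_band m A.
Proof.
by move=> le_mn bA i j lt_ji; apply: bA; rewrite (leq_trans lt_ji) ?leq_add2l.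
Qed.

Lemma upper_band1 : upper_band 0 1.
Proof. by move=> i j; rewrite addn0 mxE -val_eqE /= => /gtn_eqF->. Qed.

Lemma upper_band_eq0 A : upper_band d.+1 A -> A = 0.
Proof.
move=> bA; apply/matrixP=> i j.
by rewrite bA ?mxE // (leq_trans (ltn_ord j)) ?leq_addl.
Qed.

End UpperBand.

Section UnitriangularGroup.
Import GRing.Theory.
Variables (F : finComUnitRingType) (d : nat).
Implicit Types u v : {unit 'M[F]_d.+1}.

Definition unitriangular n : set {unit 'M[F]_d.+1} :=
  fun u => upper_band n (val u - 1)%R.

Lemma unitriangular_band u : unitriangular 1 u -> upper_band 0 (val u).
Proof.
move=> uu; rewrite -[val u](subrK 1%R).
apply: upper_bandD; last exact: upper_band1.
exact: upper_band_le uu.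
Qed.

Lemma unitriangularM n u v :
  unitriangular n.+1 u -> unitriangular n.+1 v -> unitriangular n.+1 (u * v).
Proof.
move=> uu uv; rewrite /unitriangular FinRing.val_unitM.
have -> : (val u * val v - 1 = (val u - 1) * val v + (val v - 1))%R.
  by rewrite mulrBl mul1r addrA subrK.
apply: upper_bandD => //; apply: upper_bandM0 => //.
by apply: unitriangular_band; apply: upper_band_le uv.
Qed.

Lemma unitriangular1 n : unitriangular n 1.
Proof. by move=> i j _; rewrite /= subrr mxE. Qed.

(** The unit group is finite, so an inverse is a power and closure under products suffices. *)
Lemma unitriangularV n u : unitriangular n.+1 u -> unitriangular n.+1 u^-1.
Proof.
move=> uu; rewrite fingroup.invg_expg; elim: _.-1 => [|m IHm].
  exact: unitriangular1.
by rewrite expgS; apply: unitriangularM.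
Qed.

Lemma unitriangular_subgroup n : subgroup (unitriangular n.+1).
Proof.
split; [exact: unitriangular1|exact: unitriangularM|exact: unitriangularV].
Qed.

(** It rests on [[~ u, v] - 1 = u^-1 v^-1 (u v - v u)], where [u v - v u] is also the ring
    commutator of [u - 1] and [v - 1]. *)
Lemma unitriangularR n u v :
  unitriangular n.+1 u -> unitriangular 1 v -> unitriangular n.+2 [~ u, v].
Proof.
move=> uu uv; have u1 : unitriangular 1 u by apply: upper_band_le uu.
rewrite /unitriangular.
have -> : (val [~ u, v] - 1 = val (u^-1 * v^-1)%g *
    ((val u - 1) * (val v - 1) - (val v - 1) * (val u - 1)))%R.
  have -> : ((val u - 1) * (val v - 1) - (val v - 1) * (val u - 1) =
      val (u * v)%g - val (v * u)%g)%R.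
    have mulB a b : ((a - 1) * (b - 1) = a * b - (a + b - 1) :> 'M[F]_d.+1)%R.
      by rewrite mulrBl mul1r mulrBr mulr1 -addrA -opprD addrA.
    rewrite FinRing.val_unitM FinRing.val_unitM !mulB (addrC (val v)).
    by move: (_ + _ - 1)%R => s; rewrite opprB addrA subrK.
  rewrite mulrBr -!FinRing.val_unitM -[in RHS]invgM mulVg /commg /conjg.
  by rewrite invgM !mulgA.
apply: upper_band0M.
  by apply: unitriangular_band; apply: unitriangularM; apply: unitriangularV.
apply: upper_bandD; first by rewrite -addn1; apply: upper_bandM.
by apply: upper_bandN; rewrite -add1n; apply: upper_bandM.
Qed.

Lemma lower_central_unitriangular (G : groupType)
    (f : UMagmaMorphism.type G {unit 'M[F]_d.+1}) n x :
    (forall g, unitriangular 1 (f g)) ->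
  lower_central G n.+1 x -> unitriangular n.+1 (f x).
Proof.
move=> uf; elim: n x => [|n IHn] x //.
apply: (@smallest_sub _ _ _ (f @^-1` unitriangular n.+2)).
  by apply: preimage_subgroup; apply: unitriangular_subgroup.
move=> _ [y [z [Ly _ ->]]]; rewrite /preimage/= /mkset gmulfR.
by apply: unitriangularR; [apply: IHn|apply: uf].
Qed.

(** The filtration by bands is trivial from width [d.+1] on, so the term of index [d.+1] is already
    killed. *)
Lemma lower_central_omega_unitriangular (G : groupType)
    (f : UMagmaMorphism.type G {unit 'M[F]_d.+1}) x :
    (forall g, unitriangular 1 (f g)) ->
  lower_central_omega G x -> val (f x) = 1%R.
Proof.
move=> uf Lx; apply/eqP; rewrite -subr_eq0; apply/eqP/upper_band_eq0.
by apply: lower_central_unitriangular => //; apply: Lx.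
Qed.

End UnitriangularGroup.

(** * Matrices acting on a labelled path *)

Section StepMatrices.
Local Open Scope ring_scope.
Import GRing.Theory.
Variables (R : nzRingType) (t : seq bool).
Local Notation d := (size t).

(* Acts on a path labelled by [t] by advancing along the edges labelled [c]. As
   in Magnus' embedding a generator [c] will act as [1 + step_mx c]; over ['F_p]
   its [p ^ e]-th power is 1 when [t] has no run of [p ^ e] letters [c]. *)
Definition step_mx (c : bool) : 'M[R]_d.+1 :=
  \matrix_(i, j) ((j == i.+1 :> nat) && (nth false t i == c))%:R.

Lemma step_mx_band c : upper_band 1 (step_mx c).
Proof. by move=> i j; rewrite addn1 mxE => /ltn_eqF->. Qed.

(** A nonzero entry comes from a path of [m] edges labelled [c] from [i] to [j]. As [j] is at most
    [size t], the conclusion reads genuine letters of [t], never the default of [nth]. *)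
Lemma step_mxX_neq0 c m (i j : 'I_d.+1) : (step_mx c ^+ m) i j != 0 ->
  j = (i + m)%N :> nat /\ forall x, (x < m)%N -> nth false t (i + x) = c.
Proof.
elim: m i => [|m IHm] i.
  by rewrite mxE addn0; case: (i =P j) => [->|_] //; rewrite eqxx.
rewrite exprS mxE => nz.
have [x /andP[]|zero] := pickP (fun x => (step_mx c i x != 0) &&
                            ((step_mx c ^+ m) x j != 0)); last first.
  move: nz; rewrite big1 ?eqxx // => x _.
  have := zero x; case: (step_mx c i x =P 0) => [->|_]; first by rewrite mul0r.
  by case: (_ =P 0) => [->|_] //; rewrite mulr0.
rewrite mxE; case: (x =P i.+1 :> nat) => [xi|_]; last by rewrite eqxx.
case: (nth false t i =P c) => [ti _|_]; last by rewrite eqxx.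
case/IHm=> -> tc; split=> [|[|y] lt_ym]; first by rewrite xi addSnnS.
  by rewrite addn0.
by rewrite -addSnnS -xi tc.
Qed.

Lemma step_mxX_eq0 c m : ~~ infix (nseq m c) t -> step_mx c ^+ m = 0.
Proof.
move=> no_run; apply/matrixP=> i j; rewrite [RHS]mxE; apply/eqP.
apply: contraNT no_run => /step_mxX_neq0[jE tc]; apply/infixP.
exists (take i t), (drop (i + m) t).
have le_imd : (i + m <= d)%N by rewrite -jE -ltnS ltn_ord.
have -> : nseq m c = take m (drop i t).
  have sz : size (take m (drop i t)) = m.
    by rewrite size_takel // size_drop leq_subRL //
      (leq_trans (leq_addr _ _) le_imd).
  apply: (@eq_from_nth _ false) => [|x]; rewrite size_nseq ?sz // => lt_xm.
  by rewrite nth_nseq lt_xm nth_take // nth_drop tc.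
by rewrite addnC -drop_drop cat_take_drop cat_take_drop.
Qed.

(* A product of [n] factors [1 + step_mx c] moves a basis vector by at most [n]
   steps, and does so in exactly one way when its letters spell [t]. *)
Lemma prod_step_mx0 (u : seq bool) (i j : 'I_d.+1) :
  (i + size u < j)%N -> (\prod_(c <- u) (1 + step_mx c)) i j = 0.
Proof.
elim: u i => [|c u IHu] i /= lt_ij.
  by rewrite big_nil mxE -val_eqE /= ltn_eqF // -[val i]addn0.
rewrite big_cons mulrDl mul1r mxE IHu ?add0r; last first.
  by apply: leq_trans lt_ij; rewrite addnS ltnS leqnSn.
rewrite mxE big1 // => x _; rewrite mxE.
have [xi|_] := eqVneq (x : nat) i.+1; last by rewrite mul0r.
by rewrite IHu ?mulr0 // xi addSnnS.
Qed.

Lemma prod_step_mx1 (u : seq bool) (i : 'I_d.+1) : drop i t = u ->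
  (\prod_(c <- u) (1 + step_mx c)) i ord_max = 1.
Proof.
elim: u i => [|c u IHu] i tu.
  have le_di : (d <= i)%N by rewrite -subn_eq0 -size_drop tu.
  by rewrite big_nil mxE -val_eqE /= eqn_leq le_di -ltnS ltn_ord.
have lt_id : (i < d)%N by rewrite -subn_gt0 -size_drop tu.
move: tu; rewrite (drop_nth false) // => -[ti tu].
have szu : (i + size u).+1 = d by rewrite -tu size_drop -addSn subnKC.
(* If the first factor stays at [i], the other factors fall one step short of the last vertex; only
   the advance along the edge labelled [c] contributes. *)
rewrite big_cons mulrDl mul1r mxE prod_step_mx0 ?add0r /=; last by rewrite szu.
have lt_i1 : (i.+1 < d.+1)%N by [].
rewrite mxE (bigD1 (Ordinal lt_i1)) //= mxE eqxx ti eqxx mul1r.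
rewrite (IHu (Ordinal lt_i1)) //.
rewrite big1 ?addr0 // => x /eqP nx; rewrite mxE.
by case: eqP => [xi|_]; rewrite ?mul0r //; case: nx; apply: val_inj.
Qed.

End StepMatrices.

(** The Frobenius identity is iterated; it holds in a noncommutative ring here because 1 commutes
    with [x]. *)
Lemma exprD1_pchar (R : nzRingType) (x : R) p e :
  p \in [pchar R]%R -> ((1 + x) ^+ (p ^ e) = 1 + x ^+ (p ^ e))%R.
Proof.
move=> pR; elim: e => [|e IHe]; first by rewrite !GRing.expr1.
rewrite expnSr !GRing.exprM IHe -!(GRing.pFrobenius_autE pR).
rewrite GRing.pFrobenius_autD_comm ?GRing.pFrobenius_aut1 //.
exact: GRing.commr_sym (GRing.commr1 _).
Qed.

(** * Reduction of elements to positive words modulo a central element *)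

Section PositiveWords.
Variables (G : groupType) (x y : G).

Definition eval_word (t : seq bool) : G := \prod_(c <- t) (if c then x else y).

Lemma eval_word_cat s t : eval_word (s ++ t) = eval_word s * eval_word t.
Proof. exact: big_cat. Qed.

Lemma eval_word_nseq m c : eval_word (nseq m c) = (if c then x else y) ^+ m.
Proof.
elim: m => [|m IHm]; first exact: big_nil.
by rewrite /eval_word big_cons -/(eval_word _) IHm expgS.
Qed.

Variables (z : G) (m n i j : nat).
Hypotheses (z_central : forall g, commute z g) (m_gt0 : 0 < m) (n_gt0 : 0 < n).
Hypotheses (xm : x ^+ m = z ^+ i) (yn : y ^+ n = z ^+ j).

(** Powers of [z] on both sides stand in for an integer exponent. *)
Let has_word h := exists u v t, h * z ^+ u = eval_word t * z ^+ v.

Let zX_central u g : z ^+ u * g = g * z ^+ u.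
Proof. by rewrite -[LHS]commuteX //; apply: commute_sym. Qed.

(** Closure of [has_word] under inverses is not immediate, but the [g] whose left multiplication
    preserves and reflects it form a subgroup. For [x] the reflection holds since
    [x ^+ m.-1 * (x * h) = z ^+ i * h]. *)
Lemma generated_has_word g : generated [set x; y] g -> has_word g.
Proof.
move=> gen_g; suff: forall h, has_word h <-> has_word (g * h).
  move=> /(_ 1)[+ _]; rewrite mulg1; apply.
  by exists 0, 0, [::]; rewrite /eval_word big_nil.
apply: (@smallest_sub _ _ _
  (fun g => forall h, has_word h <-> has_word (g * h)) _ _ g gen_g).
  split=> [h|a b wa wb h|a wa h]; first (split; by rewrite mul1g).
    by rewrite -mulgA; split=> [/wb/wa|wh]; last apply/wb/wa.
  by split=> [wh|/wa]; [apply/wa|]; rewrite mulVKg.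
have wz u h : has_word (z ^+ u * h) -> has_word h.
  case=> u' [v [t E]]; exists (u + u'), v, t.
  by rewrite expgnDr mulgA -(zX_central u).
have wx c h : has_word h -> has_word ((if c then x else y) * h).
  case=> u [v [t E]]; exists u, v, (c :: t).
  by rewrite /eval_word big_cons -!mulgA E.
have wX c r h : has_word h -> has_word ((if c then x else y) ^+ r * h).
  by move=> wh; elim: r => [|r IHr]; rewrite ?mul1g // expgS -mulgA; apply: wx.
move=> a [|] -> h.
  split=> [|wh]; first exact: (wx true).
  by apply: (wz i); rewrite -xm -(prednK m_gt0) expgSr -mulgA; apply: (wX true).
split=> [|wh]; first exact: (wx false).
by apply: (wz j); rewrite -yn -(prednK n_gt0) expgSr -mulgA; apply: (wX false).
Qed.

(** A run of [m] letters [true] or [n] letters [false] evaluates to a power of [z], which moves out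
    of the word; induction on the length removes all runs. *)
Lemma generated_reduced_word g : generated [set x; y] g ->
  exists u v t, [/\ g * z ^+ u = eval_word t * z ^+ v,
    ~~ infix (nseq m true) t & ~~ infix (nseq n false) t].
Proof.
case/generated_has_word=> u [v [t]].
have [N] := ubnP (size t); elim: N t v => // N IHN t v lt_tN E.
have reduce c r e : 0 < r -> (if c then x else y) ^+ r = z ^+ e ->
    infix (nseq r c) t -> exists u v t, [/\ g * z ^+ u = eval_word t * z ^+ v,
    ~~ infix (nseq m true) t & ~~ infix (nseq n false) t].
  move=> r_gt0 cr /infixP[s1 [s2 tE]]; apply: (IHN (s1 ++ s2) (e + v)).
    apply: leq_trans (lt_tN : size t <= N); rewrite tE !size_cat size_nseq.
    by rewrite ltn_add2l -[ltnLHS]add0n ltn_add2r.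
  rewrite E tE !eval_word_cat eval_word_nseq cr expgnDr.
  by rewrite -!mulgA [z ^+ e * (eval_word s2 * _)]mulgA zX_central -!mulgA.
have [tx|ntx] := boolP (infix (nseq m true) t); first exact: (reduce true m i).
have [ty|nty] := boolP (infix (nseq n false) t).
  exact: (reduce false n j).
by exists u, v, t.
Qed.

End PositiveWords.

Lemma gmulf_eval_word (G H : groupType) (f : UMagmaMorphism.type G H) x y t :
  f (eval_word x y t) = eval_word (f x) (f y) t.
Proof. by rewrite gmulf_prod; apply: eq_bigr => -[]. Qed.

(** In characteristic p the power in question is 1 plus the same power of [step_mx], which vanishes
    for lack of a run. A positive power equal to 1 also gives invertibility. *)
Lemma step_unit_exists p (t : seq bool) (c : bool) m : prime p ->
    ~~ infix (nseq m`_p%N c) t ->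
  exists x : {unit 'M['F_p]_((size t).+1)},
    val x = (1 + step_mx 'F_p t c)%R /\ x ^+ m`_p%N = 1.
Proof.
move=> p_pr no_run; pose X := step_mx 'F_p t c.
have p_char : p \in [pchar 'M['F_p]_((size t).+1)]%R.
  by rewrite GRing.pchar_lalg pchar_Fp.
have X1 : ((1 + X) ^+ m`_p%N = 1)%R.
  by rewrite {1}p_part exprD1_pchar // -p_part step_mxX_eq0 // GRing.addr0.
have uX : (1 + X)%R \is a GRing.unit.
  by rewrite -(GRing.unitrX_pos _ (part_gt0 p m)) X1 GRing.unitr1.
exists (FinRing.Unit uX); split=> //; apply: val_inj.
by rewrite FinRing.val_unitX.
Qed.

(** * Products of commuting morphisms and central factors *)

Lemma prod_morphism (I : eqType) (G H : groupType) (r : seq I)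
    (f : I -> UMagmaMorphism.type G H) :
    uniq r ->
    (forall i j x y, i \in r -> j \in r -> i != j -> commute (f i x) (f j y)) ->
  exists F : UMagmaMorphism.type G H, forall x, F x = \prod_(i <- r) f i x.
Proof.
move=> r_uniq fC; pose F x := \prod_(i <- r) f i x.
have F_morph : monoid_morphism F.
  split=> [|x y]; first by rewrite /F big1 // => i _; rewrite gmulf1.
  rewrite /F; elim: r r_uniq fC {F} => [_ _|i r IHr /andP[ir r_uniq] fC].
    by rewrite !big_nil mulg1.
  rewrite !big_cons gmulfM IHr //; last first.
    by move=> j j' x' y' jr j'r; apply: fC; rewrite inE ?jr ?j'r orbT.
  rewrite -!mulgA; congr (_ * _); rewrite !mulgA; congr (_ * _).
  rewrite !big_seq; apply: commute_prod => j jr.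
  apply: fC; rewrite ?mem_head //.
    by rewrite inE jr orbT.
  by apply: contraNneq ir => ->.
by exists (HB.pack_for (UMagmaMorphism.type G H) F
  (isUMagmaMorphism.Build G H F F_morph)).
Qed.

Lemma commg_mul_central (G : groupType) (u v x y : G) :
    (forall g, commute u g) -> (forall g, commute v g) ->
  [~ u * x, v * y] = [~ x, y].
Proof.
have comm_central (w s t : G) :
    (forall g, commute w g) -> [~ w * s, t] = [~ s, t].
  move=> wC; rewrite /commg conjMg [w ^ t]conjgE (wC t) mulKg.
  by rewrite invgM -mulgA mulKg.
by move=> uC vC; rewrite comm_central // -invgR comm_central // invgR.
Qed.

(** * Primary idempotents modulo n *)

Lemma eq_mod_parts n x y : (0 < n)%N ->
  (forall p, p \in primes n -> (x = y %[mod n`_p])%N) -> (x = y %[mod n])%N.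
Proof.
move=> n_gt0; wlog le_yx : x y / (y <= x)%N => [IH|] xy.
  have [/IH|/ltnW/IH] := leqP y x; first exact.
  by move=> yx; symmetry; apply: yx => p /xy.
apply/eqP; rewrite eqn_mod_dvd //; apply/(dvdn_partP _ n_gt0) => p pn.
by rewrite -eqn_mod_dvd //; apply/eqP/xy.
Qed.

(* The idempotents of Z/n that cut out its primary components. *)
Definition idem_part n p := chinese n`_p n`_p^' 1 0.

Lemma idem_part1 n p : (idem_part n p = 1 %[mod n`_p])%N.
Proof. exact/chinese_modl/coprime_partC. Qed.

Lemma idem_part0 n p : (n`_p^' %| idem_part n p)%N.
Proof.
have := chinese_modr (coprime_partC p n n) 1 0.
by rewrite -/(idem_part n p) mod0n => /eqP.
Qed.

Lemma dvdn_partC n p q : p != q -> prime p -> prime q -> (n`_p %| n`_q^')%N.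
Proof.
move=> npq p_pr q_pr; rewrite -[X in (X %| _)%N](@partn_part p q^').
  exact: dvdn_part.
by move=> r; rewrite !inE => /eqP->.
Qed.

(** Modulo the p-part of [n] the summand of [p] is 1 and the others vanish, since for [q != p] the
    p-part divides the part prime to [q]. *)
Lemma sum_idem_part n : (0 < n)%N ->
  (\sum_(p <- primes n) idem_part n p = 1 %[mod n])%N.
Proof.
move=> n_gt0; apply: eq_mod_parts => // p pn.
rewrite (bigD1_seq p) ?primes_uniq //= -modnDm idem_part1.
have p_pr : prime p by move: pn; rewrite mem_primes => /andP[].
suff /eqP-> : (n`_p %| \sum_(q <- primes n | q != p) idem_part n q)%N.
  by rewrite addn0 modn_mod.
rewrite big_seq_cond; apply: dvdn_sum => q /andP[].
rewrite mem_primes => /andP[q_pr _] nqp.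
by apply: dvdn_trans (idem_part0 n q); apply: dvdn_partC; rewrite // eq_sym.
Qed.

Lemma expg_central_twist (G : groupType) (x : G) m w : (w = 1 %[mod m])%N ->
    (forall i, m %| i -> forall g, commute (x ^+ i) g) ->
  exists u, (forall g, commute u g) /\ x ^+ w = u * x.
Proof.
move=> wm xC; exists (x ^+ (w %/ m * m) * x ^- (1 %/ m * m)); split=> [g|].
  apply/commute_sym/commuteM; last apply: commuteV;
    exact/commute_sym/xC/dvdn_mull.
have x1 : x = x ^+ (1 %/ m * m) * x ^+ (w %% m) by rewrite wm -expgnDr -divn_eq.
by rewrite [X in _ = _ * X]x1 -mulgA mulKg -expgnDr -divn_eq.
Qed.

(** * The amalgam *)

Section Amalgam.
Variables k l : nat.
Hypotheses (k_gt0 : 0 < k) (l_gt0 : 0 < l).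
Local Notation G := (amalgam k l).
Local Notation a := (amalgam_a k l).
Local Notation b := (amalgam_b k l).

(* A [{multiplicative G -> H}], even between groups, does not carry [f 1 = 1],
   on which the library lemmas for powers and commutators rely. *)
Lemma amalgam_morphism (H : groupType) (x y : H) : x ^+ k = y ^+ l ->
  exists f : UMagmaMorphism.type G H, f a = x /\ f b = y.
Proof.
case/amalgam_universal=> f fab.
have f1 : f 1 = 1 by apply: (mulgI (f 1)); rewrite -gmulfM !mulg1.
by exists (HB.pack_for (UMagmaMorphism.type G H) (Multiplicative.sort f)
  (Multiplicative_isUMagmaMorphism.Build G H (Multiplicative.sort f) f1)).
Qed.

Lemma amalgam_ind (P : set G) : subgroup P -> P a -> P b -> forall g, P g.
Proof.
move=> sP Pa Pb g; have: generated [set a; b] g by rewrite amalgam_generated.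
by apply: smallest_sub => // _ [] ->.
Qed.

Lemma commute_amalgam x :
  commute x a -> commute x b -> forall g : G, commute x g.
Proof.
by move=> xa xb; apply: amalgam_ind => //; apply: centralizer_subgroup.
Qed.

Lemma amalgam_relX_central w : k %| w -> forall g : G, commute (a ^+ w) g.
Proof.
case/dvdnP=> v ->; apply: commute_amalgam; apply: commute_sym.
  exact: commuteX.
by rewrite mulnC expgnA amalgam_relE -expgnA; apply: commuteX.
Qed.

Lemma amalgam_relX_central_b w : l %| w -> forall g : G, commute (b ^+ w) g.
Proof.
case/dvdnP=> v ->; apply: commute_amalgam; apply: commute_sym.
  by rewrite mulnC expgnA -amalgam_relE -expgnA; apply: commuteX.
exact: commuteX.
Qed.

(** A map to a cyclic group kills [g] and separates the powers of [a ^+ k] that occur. *)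
Lemma amalgam_rel_derived (g : G) u v :
  lower_central G 2 g -> g * (a ^+ k) ^+ u = (a ^+ k) ^+ v -> g = 1.
Proof.
(* With [a] sent to [l] and [b] to [k], the element [a ^+ k] goes to [k * l]; modulo [n.+1] neither
   [k * l * u] nor [k * l * v] wraps around. *)
move=> Lg E; pose n := (k * l * (u + v))%N.
have [|f [fa fb]] := @amalgam_morphism ('I_n.+1) (inZp l) (inZp k).
  by rewrite !Zp_expg; apply: val_inj; rewrite /= !modnMml mulnC.
have fg : f g = 1.
  apply: (@smallest_sub _ _ _ (f @^-1` [set 1]) _ _ _ Lg).
    apply: preimage_subgroup; split=> [|x y -> ->|x ->] //=.
    by rewrite mulg1.
    by rewrite invg1.
  move=> _ [x [y [_ _ ->]]]; rewrite /preimage/= /mkset gmulfR.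
  by apply/eqP/commgP; apply: GRing.addrC.
have := congr1 f E.
rewrite gmulfM !gmulfXn fg mul1g fa !Zp_expg => /(congr1 val).
rewrite /= fa /= !modnMml -!mulnA !modnMml !mulnA;
 rewrite [(l * k)%N]mulnC /n mulnDr.
rewrite !modn_small ?ltnS ?leq_addl ?leq_addr // => /eqP.
rewrite eqn_pmul2l ?muln_gt0 ?k_gt0 // => /eqP uv.
by apply: (mulIg ((a ^+ k) ^+ u)); rewrite mul1g E uv.
Qed.

(** The word [t] is tested on the path that it labels itself: its matrix has corner entry 1, while
    [g] and [a ^+ k] act trivially. The exponent [w] is invisible, as the two matrices have orders
    dividing the p-parts of [k] and [l]. *)
Lemma omega_eval_word p w t (g : G) u v : prime p ->
    (w = 1 %[mod k`_p])%N -> (w = 1 %[mod l`_p])%N ->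
    ~~ infix (nseq k`_p%N true) t -> ~~ infix (nseq l`_p%N false) t ->
    lower_central_omega G g ->
    g * (a ^+ k) ^+ u = eval_word (a ^+ w) (b ^+ w) t * (a ^+ k) ^+ v ->
  t = [::].
Proof.
move=> p_pr wk wl tk tl Lg E.
have [x [xE xk]] := step_unit_exists p_pr tk.
have [y [yE yl]] := step_unit_exists p_pr tl.
have xk1 : x ^+ k = 1.
  by rewrite -(partnC p k_gt0) expgnA xk expg1n.
have yl1 : y ^+ l = 1.
  by rewrite -(partnC p l_gt0) expgnA yl expg1n.
have expw (h : {unit 'M['F_p]_((size t).+1)}) m :
    h ^+ m = 1 -> (w = 1 %[mod m])%N -> h ^+ w = h.
  move=> hm wm; rewrite (divn_eq w m) wm expgnDr mulnC expgnA hm expg1n mul1g.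
  (* The remainder of 1 modulo [m] is 1 except for [m = 1], where [h] is trivial. *)
  by case: m hm {wm} => [|[|m]] hm; rewrite // ?modn1 ?modn_small.
have [|f [fa fb]] := @amalgam_morphism _ x y; first by rewrite xk1 yl1.
have uf h : unitriangular 1 (f h).
  apply: (@amalgam_ind (f @^-1` unitriangular 1)).
  - by apply: preimage_subgroup; apply: unitriangular_subgroup.
  - rewrite /preimage/= /mkset fa /unitriangular xE GRing.addrC GRing.addKr.
    exact: step_mx_band.
  - rewrite /preimage/= /mkset fb /unitriangular yE GRing.addrC GRing.addKr.
    exact: step_mx_band.
have fg := lower_central_omega_unitriangular uf Lg.
have /(congr1 val) := congr1 f E.
rewrite !gmulfM !gmulfXn fa xk1 !expg1n !mulg1 fg.
rewrite gmulf_eval_word !gmulfXn fa fb.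
rewrite (expw _ _ xk wk) (expw _ _ yl wl).
have -> : val (eval_word x y t) = (\prod_(c <- t) (1 + step_mx 'F_p t c))%R.
  rewrite /eval_word.
  rewrite (big_morph _ (@FinRing.val_unitM _) (@FinRing.val_unit1 _)).
  by apply: eq_bigr => -[].
move/matrixP/(_ ord0 ord_max); rewrite prod_step_mx1 ?drop0 // mxE.
case: eqP => [/(congr1 val)/= /esym/size0nil //|_] /esym/eqP.
by rewrite GRing.oner_eq0.
Qed.

Lemma power_endomorphism w :
  exists f : UMagmaMorphism.type G G, f a = a ^+ w /\ f b = b ^+ w.
Proof.
by apply: amalgam_morphism; rewrite expgnAC amalgam_relE expgnAC.
Qed.

(* The image of such an endomorphism is, modulo [a ^+ k], a free product of two
   cyclic p-groups, hence residually nilpotent. *)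
Lemma power_endomorphism_omega p w (f : UMagmaMorphism.type G G) g : prime p ->
    (w = 1 %[mod k`_p])%N -> (w = 1 %[mod l`_p])%N ->
    (k`_p^' %| w)%N -> (l`_p^' %| w)%N ->
    f a = a ^+ w -> f b = b ^+ w ->
  lower_central_omega G g -> f g = 1.
Proof.
move=> p_pr wk wl wk' wl' fa fb Lg.
(* It makes suitable p-power powers of [a ^+ w] and [b ^+ w] into powers of the central [a ^+ k], as
   the reduction to words requires. *)
have wM m : 0 < m -> (m`_p^' %| w)%N -> (w * m`_p = m * (w %/ m`_p^'))%N.
  move=> m_gt0 mw; rewrite -{2}(partnC p m_gt0) -mulnA.
  by rewrite [(m`_p^' * _)%N]mulnC divnK // mulnC.
have iE : (a ^+ w) ^+ k`_p%N = (a ^+ k) ^+ (w %/ k`_p^')%N.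
  by rewrite -!expgnA wM.
have jE : (b ^+ w) ^+ l`_p%N = (a ^+ k) ^+ (w %/ l`_p^')%N.
  by rewrite amalgam_relE -!expgnA wM.
have fg_gen : generated [set a ^+ w; b ^+ w] (f g).
  apply: (@amalgam_ind (f @^-1` generated _)).
  - by apply: preimage_subgroup; apply: generated_subgroup.
  - by apply: sub_generated; left.
  - by apply: sub_generated; right.
have Lfg := lower_central_omega_morph f Lg.
have [u [v [t [E tk tl]]]] := generated_reduced_word
  (amalgam_relX_central (dvdnn k)) (part_gt0 p k) (part_gt0 p l) iE jE fg_gen.
(* The reduced word is empty, so [f g] is a power of [a ^+ k] up to another such power; lying in the
   derived subgroup, it is 1. *)
move: (E); rewrite (omega_eval_word p_pr wk wl tk tl Lfg E).
rewrite /eval_word big_nil mul1g.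
by apply: amalgam_rel_derived; apply: (Lfg 2).
Qed.

End Amalgam.

(** * Comparison of morphisms, and the upper bound for the intersection *)

Section CentralTwist.
Variables (k l : nat) (H : groupType).
Variables F f : UMagmaMorphism.type (amalgam k l) H.

(** Central discrepancies on the generators propagate to all of the group, and commutators do not
    see them. *)
Lemma central_twist_derived u v :
    (forall h : H, commute u h) -> (forall h : H, commute v h) ->
    F (amalgam_a k l) = u * f (amalgam_a k l) ->
    F (amalgam_b k l) = v * f (amalgam_b k l) ->
  forall g, lower_central (amalgam k l) 2 g -> F g = f g.
Proof.
move=> uC vC Fa Fb.
have twist g : exists w, (forall h : H, commute w h) /\ F g = w * f g.
  move: g; apply: (@amalgam_ind k l
    (fun g => exists w, (forall h : H, commute w h) /\ F g = w * f g)).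
  - split=> [|x y [w [wC Fx]] [s [sC Fy]]|x [w [wC Fx]]].
    + exists 1; split=> [h|]; last by rewrite !gmulf1 mul1g.
      exact/commute_sym/commute1.
    + exists (w * s); split=> [h|].
        by apply/commute_sym/commuteM; apply: commute_sym.
      by rewrite gmulfM gmulfM Fx Fy -!mulgA; congr (_ * _); rewrite !mulgA -sC.
    + exists w^-1; split=> [h|].
        exact/commute_sym/commuteV/commute_sym.
      by rewrite !gmulfV Fx invgM; apply: commuteV; apply/commute_sym/commuteV.
  - by exists u.
  - by exists v.
move=> g; apply: (@smallest_sub _ _ _ (fun g => F g = f g)).
  split=> [|x y|x]; rewrite ?gmulf1 ?gmulfM ?gmulfV //; first by move=> -> ->.
  by move=> ->.
move=> _ [x [y [_ _ ->]]]; rewrite !gmulfR.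
have [w [wC ->]] := twist x; have [s [sC ->]] := twist y.
exact: commg_mul_central.
Qed.

End CentralTwist.

Lemma commute_morphisms k l (H : groupType)
    (f g : UMagmaMorphism.type (amalgam k l) H) :
  let a := amalgam_a k l in let b := amalgam_b k l in
    commute (f a) (g a) -> commute (f a) (g b) ->
    commute (f b) (g a) -> commute (f b) (g b) ->
  forall x y, commute (f x) (g y).
Proof.
move=> a b aa ab ba bb x y.
have gC h : commute h (g a) -> commute h (g b) -> commute h (g y).
  move=> ha hb.
  apply: (@amalgam_ind k l (g @^-1` [set h' | commute h h'])) => //.
  by apply: preimage_subgroup; apply: centralizer_subgroup.
apply: commute_sym.
apply: (@amalgam_ind k l (f @^-1` [set h | commute (g y) h])).
- by apply: preimage_subgroup; apply: centralizer_subgroup.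
- by apply/commute_sym/gC.
- by apply/commute_sym/gC.
Qed.

Section OmegaUpperBound.
Variables k l : nat.
Hypotheses (k_gt0 : 0 < k) (l_gt0 : 0 < l).
Local Notation G := (amalgam k l).
Local Notation a := (amalgam_a k l).
Local Notation b := (amalgam_b k l).

(** The commutators in the hypothesis are those that make [pi p] and [pi q] commute modulo [N]: the
    part of [k * l] prime to [p] divides the idempotent of [p]. *)
Lemma omega_sub_normal (N : set G) : normal_subgroup N ->
    (forall p q, p \in primes (k * l) -> q \in primes (k * l) -> p != q ->
       N [~ a ^+ ((k * l)`_p^')%N, b ^+ ((k * l)`_q^')%N]) ->
  lower_central_omega G `<=` N.
Proof.
move=> nN Ncomm g Lg; pose n := (k * l)%N.
have n_gt0 : (0 < n)%N by rewrite muln_gt0 k_gt0.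
pose w := idem_part n.
pose pi p := sval (cid (@power_endomorphism k l (w p))).
have piE p : pi p a = a ^+ w p /\ pi p b = b ^+ w p.
  by rewrite /pi; case: (cid _).
pose bar : UMagmaMorphism.type G (quotient_group nN) := quotient_proj nN.
pose f p : UMagmaMorphism.type G (quotient_group nN) := bar \o pi p.
have fC p q x y : p \in primes n -> q \in primes n -> p != q ->
    commute (f p x) (f q y).
  have ab r s : r \in primes n -> s \in primes n -> r != s ->
      commute (bar (a ^+ w r)) (bar (b ^+ w s)).
    move=> rn sn nrs.
    have /dvdnP[i wr] := idem_part0 n r; have /dvdnP[j ws] := idem_part0 n s.
    rewrite /w wr ws ![(_ * n`__)%N]mulnC !expgnA 2!(gmulfXn bar _ (_ ^+ _)).
    apply/commuteX2/commgP/eqP; rewrite -gmulfR.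
    exact/quotient_proj_eq1/Ncomm.
  move=> pn qn npq; have [pa pb] := piE p; have [qa qb] := piE q.
  apply: commute_morphisms => /=; rewrite ?pa ?pb ?qa ?qb.
  - by apply/gmulf_commute/commuteX2.
  - exact: ab.
  - by apply/commute_sym/ab; rewrite // eq_sym.
  - by apply/gmulf_commute/commuteX2.
have [F FE] := prod_morphism (primes_uniq n) fC.
have FX c : (forall p, pi p c = c ^+ w p) ->
    F c = bar (c ^+ (\sum_(p <- primes n) w p)).
  move=> pic; rewrite FE -prodgXr gmulf_prod; apply: eq_bigr => p _.
  by rewrite /= pic.
have bar_central u : (forall g, commute u g) -> forall h, commute (bar u) h.
  by move=> uC h; have [x ->] := quotient_proj_surj h; apply: gmulf_commute.
have sum_mod m : (m %| n)%N -> (\sum_(p <- primes n) w p = 1 %[mod m])%N.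
  by move=> mn; rewrite -(modn_dvdm _ mn) sum_idem_part // modn_dvdm.
have [u [uC uE]] := expg_central_twist (sum_mod k (dvdn_mulr l (dvdnn k)))
                      (@amalgam_relX_central k l).
have [v [vC vE]] := expg_central_twist (sum_mod l (dvdn_mull k (dvdnn l)))
                      (@amalgam_relX_central_b k l).
apply/(quotient_proj_eq1 nN).
(* On the derived subgroup the projection [bar] agrees with [F], each factor of which is trivial at
   [g]. *)
rewrite -[LHS](central_twist_derived (F := F)
  (bar_central _ uC) (bar_central _ vC)).
- rewrite FE big_seq big1 // => p pn.
  have p_pr : prime p by move: pn; rewrite mem_primes => /andP[].
  have kn : (k %| n)%N := dvdn_mulr l (dvdnn k).
  have ln : (l %| n)%N := dvdn_mull k (dvdnn l).
  have part1 m : (m %| n)%N -> (w p = 1 %[mod m`_p])%N.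
    move=> mn; rewrite -(modn_dvdm _ (partn_dvd p n_gt0 mn)) idem_part1.
    by rewrite modn_dvdm // partn_dvd.
  have part0 m : (m %| n)%N -> (m`_p^' %| w p)%N.
    by move=> mn; apply: dvdn_trans (idem_part0 n p); apply: partn_dvd.
  have [pa pb] := piE p.
  rewrite /= (power_endomorphism_omega k_gt0 l_gt0 p_pr
    (part1 _ kn) (part1 _ ln) (part0 _ kn) (part0 _ ln) pa pb Lg).
  exact: (gmulf1 (s := bar)).
- by rewrite FX ?uE ?gmulfM // => p; case: (piE p).
- by rewrite FX ?vE ?gmulfM // => p; case: (piE p).
- exact: (Lg 2).
Qed.

End OmegaUpperBound.

(** * Divisibility and the final description *)

Lemma normal_subgroup_commX (G : groupType) (N : set G) x y u v :
  normal_subgroup N -> N [~ x, y] -> N [~ x ^+ u, y ^+ v].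
Proof.
move=> nN Nxy; apply/(quotient_proj_eq1 nN).
rewrite gmulfR !gmulfXn; apply/eqP/commgP/commuteX2/commgP/eqP.
by rewrite -gmulfR; apply/quotient_proj_eq1.
Qed.

Lemma dvdn_partC_coprime n x p : (0 < n)%N ->
  (x %| n)%N -> coprime x p -> prime p -> (x %| n`_p^')%N.
Proof.
move=> n_gt0 xn xp p_pr; rewrite -(@Gauss_dvdr _ n`_p) ?partnC //.
by rewrite p_part coprimeXr.
Qed.

Lemma coprime_primes p q : prime p -> prime q -> p <> q -> coprime p q.
Proof.
by move=> p_pr q_pr npq; rewrite prime_coprime // dvdn_prime2 //; apply/eqP.
Qed.

Lemma coprime_prodX (I : finType) (P : pred I) (p e : I -> nat) m :
  (forall i, P i -> coprime (p i) m) -> coprime (\prod_(i | P i) p i ^ e i)%N m.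
Proof.
move=> cop; elim/big_ind: _ => [|x y xm ym|i Pi]; first exact: coprime1n.
  by rewrite coprimeMl xm.
by rewrite coprimeXl // cop.
Qed.

(** For [s = 0] the set of commutators is empty, yet for coprime [k] and [l] above 1 the nontrivial
    [[~ a, b]] lies in every term of the series; [s_eq0] excludes this case. *)
Theorem theorem3p4 (k l s n m : nat)
    (p kappa lambda : 'I_s -> nat)
    (q kappa' : 'I_n -> nat)
    (r lambda' : 'I_m -> nat)
    (p_prime : forall i, prime (p i))
    (q_prime : forall j, prime (q j))
    (r_prime : forall j, prime (r j))
    (p_inj : injective p) (q_inj : injective q) (r_inj : injective r)
    (pq_neq : forall i j, p i <> q j)
    (pr_neq : forall i j, p i <> r j)
    (qr_neq : forall i j, q i <> r j)
    (kappa_gt0 : forall i, (0 < kappa i)%N)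
    (lambda_gt0 : forall i, (0 < lambda i)%N)
    (kappa'_gt0 : forall j, (0 < kappa' j)%N)
    (lambda'_gt0 : forall j, (0 < lambda' j)%N)
    (k_fact : k = ((\prod_(i < s) p i ^ kappa i) *
                   (\prod_(j < n) q j ^ kappa' j))%N)
    (l_fact : l = ((\prod_(i < s) p i ^ lambda i) *
                   (\prod_(j < m) r j ^ lambda' j))%N)
    (s_eq0 : s = 0%N -> k = 1%N \/ l = 1%N) :
  let a := amalgam_a k l in
  let b := amalgam_b k l in
  let c (i : 'I_s) := (p i ^ kappa i)%N in
  let d (i : 'I_s) := (\prod_(j < s | j != i) p j ^ lambda j)%N in
  let e (i : 'I_s) := (p i ^ lambda i)%N in
  let f (i : 'I_s) := (\prod_(j < s | j != i) p j ^ kappa j)%N in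
  lower_central_omega (amalgam k l) =
  normal_closure
    ([set [~ a ^+ c i, b ^+ d i] | i in [set: 'I_s]] `|`
     [set [~ b ^+ e i, a ^+ f i] | i in [set: 'I_s]]).
Proof.
move=> a b c d e f.
set Q := (\prod_(j < n) _)%N in k_fact; set R := (\prod_(j < m) _)%N in l_fact.
have pX_gt0 h i : (0 < p i ^ h i)%N by rewrite expn_gt0 prime_gt0.
have k_gt0 : (0 < k)%N.
  by rewrite k_fact muln_gt0 !prodn_gt0 // => j; rewrite expn_gt0 prime_gt0.
have l_gt0 : (0 < l)%N.
  by rewrite l_fact muln_gt0 !prodn_gt0 // => j; rewrite expn_gt0 prime_gt0.
have kE i : k = (c i * (f i * Q))%N by rewrite k_fact (bigD1 i) //= mulnA.
have lE i : l = (e i * (d i * R))%N by rewrite l_fact (bigD1 i) //= mulnA.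
have pp_coprime i j : j != i -> coprime (p j) (p i).
  by move=> /eqP nij; apply: coprime_primes => // /p_inj.
have QR_coprime : coprime Q R.
  apply: coprime_prodX => i _; rewrite coprime_sym; apply: coprime_prodX => j _.
  by rewrite coprime_sym; apply: coprime_primes.
have pR_coprime i : coprime (p i) R.
  rewrite coprime_sym; apply: coprime_prodX => j _.
  by rewrite coprime_sym; apply: coprime_primes.
have pQ_coprime i : coprime (p i) Q.
  rewrite coprime_sym; apply: coprime_prodX => j _.
  by rewrite coprime_sym; apply: coprime_primes.
have dp_coprime i : coprime (d i) (p i).
  by apply: coprime_prodX => j /pp_coprime.
have fp_coprime i : coprime (f i) (p i).
  by apply: coprime_prodX => j /pp_coprime.
set S := _ `|` _; have nN := normal_closure_normal S.
apply/seteqP; split; last first.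
  apply: smallest_sub; first exact: lower_central_omega_normal.
  move=> _ [[i _ <-]|[i _ <-]].
    (* These exponents complete [c i] to [k] and [d i] to [l]; they are coprime because [f i * Q]
       omits [p i] and all [r j]. *)
    apply: (@coprime_commg_omega _ _ _ (f i * Q) (e i * R)).
    - rewrite coprimeMl !coprimeMr QR_coprime coprimeXr //=.
      rewrite coprime_prodX => [|j _]; last exact: pR_coprime.
      by rewrite coprime_sym coprimeXl.
    - by rewrite -expgnA -kE; apply: amalgam_relX_central.
    - by rewrite -expgnA mulnCA -lE; apply: amalgam_relX_central_b.
  apply: (@coprime_commg_omega _ _ _ (d i * R) (c i * Q)).
  - rewrite coprimeMl !coprimeMr [coprime R Q]coprime_sym QR_coprime.
    rewrite coprimeXr //=.
    rewrite coprime_prodX => [|j _]; last exact: pQ_coprime.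
    by rewrite coprime_sym coprimeXl // pR_coprime.
  - by rewrite -expgnA -lE; apply: amalgam_relX_central_b.
  - by rewrite -expgnA mulnCA -kE; apply: amalgam_relX_central.
apply: omega_sub_normal => // P P' Pn P'n nPP'.
(* Without common primes, [k = 1] or [l = 1] makes [a] or [b] central. *)
have [s0|s_gt0] := posnP s.
  have N1 : normal_closure S 1 by case: nN => -[].
  suff /commgP/eqP-> :
    commute (a ^+ ((k * l)`_P^')%N) (b ^+ ((k * l)`_P'^')%N) by [].
  case: (s_eq0 s0) => one.
    by apply: amalgam_relX_central; rewrite one dvd1n.
  by apply/commute_sym; apply: amalgam_relX_central_b; rewrite one dvd1n.
have kl_gt0 : (0 < k * l)%N by rewrite muln_gt0 k_gt0.
have P_pr : prime P by move: Pn; rewrite mem_primes => /andP[].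
have P'_pr : prime P' by move: P'n; rewrite mem_primes => /andP[].
have in_part x T : prime T -> coprime x T -> (x %| k)%N || (x %| l)%N ->
    exists y, ((k * l)`_T^' = x * y)%N.
  move=> T_pr xT x_dvd; suff /dvdnP[y ->] : (x %| (k * l)`_T^')%N.
    by exists y; rewrite mulnC.
  apply: dvdn_partC_coprime => //.
  by case/orP: x_dvd => x_dvd; [apply: dvdn_mulr|apply: dvdn_mull].
(* Here [c i] and [d i] divide the two exponents, so the commutator is one of powers of [a ^+ c i]
   and [b ^+ d i]. *)
have cd i : P <> p i -> coprime (d i) P' ->
    normal_closure S [~ a ^+ ((k * l)`_P^')%N, b ^+ ((k * l)`_P'^')%N].
  move=> nPi dP'.
  have [||u ->] := in_part (c i) P P_pr.
    exact/coprimeXl/coprime_primes/nesym.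
    by rewrite (kE i) dvdn_mulr.
  have [||v ->] := in_part (d i) P' P'_pr => //.
    by rewrite (lE i) mulnCA dvdn_mulr // orbT.
  rewrite !expgnA; apply: (@normal_subgroup_commX _ (normal_closure S)) => //.
  by apply: (@sub_normal_closure _ S); left; exists i.
(* If [P'] is some [p i], then [d i] omits it; otherwise every [d i] is prime to [P'], and any [i]
   with [p i] different from [P] serves. *)
have [[i P'E]|nP'] := pselect (exists i, P' = p i).
  by apply: (cd i); rewrite -?P'E //; [apply/eqP|rewrite P'E].
have P'_coprime i : coprime (d i) P'.
  apply: coprime_prodX => j _; apply: coprime_primes => // E.
  by apply: nP'; exists j.
have [[i PE]|nP] := pselect (exists i, P = p i); last first.
  by apply: (cd (Ordinal s_gt0)) => // E; apply: nP; exists (Ordinal s_gt0).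
(* Only [P = p i] with [P'] not common remains; the second family applies, as [f i] omits [P] and
   [e i] is prime to [P']. *)
have [||u ->] := in_part (f i) P P_pr; first by rewrite PE.
  by rewrite (kE i) mulnCA dvdn_mulr.
have [||v ->] := in_part (e i) P' P'_pr.
    by apply/coprimeXl/coprime_primes => // E; apply: nP'; exists i.
  by rewrite (lE i) dvdn_mulr // orbT.
have [[_ _ NV] _] := nN; rewrite -invgR; apply: NV.
rewrite !expgnA; apply: (@normal_subgroup_commX _ (normal_closure S)) => //.
by apply: (@sub_normal_closure _ S); right; exists i.
Qed.
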